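(* Let $V$ be the evaluation function of a weighted separable attribute model with utility function $u$ and weight function $w$, and let $u^{0}(t)=u(t)w(t,0)$ for $t\in\mathbb{R}$. The following two statements are equivalent. (a) (Injective) For all real $t>s>0$, $u^{0}(t)\neq u^{0}(s)$. (b) For all real $x_{1},y_{2}>0$, with the two-attribute alternatives $x=(x_{1},0)$ and $y=(0,y_{2})$, one has $V(x|\{x,y\})=V(y|\{y,x\})$ if and only if $x_{1}=y_{2}$. The result also holds when the alternatives have additional attributes with constants: for every $N\geq 3$ and all $c_{3},\dots,c_{N}\in\mathbb{R}$, (a) is equivalent to the statement obtained from (b) by replacing $x$ and $y$ with $x=(x_{1},0,c_{3},\dots,c_{N})$ and $y=(0,y_{2},c_{3},\dots,c_{N})$.
   Context: An alternative is a vector $x=(x_{1},\dots,x_{N})\in\mathbb{R}^{N}$ of attribute values. A utility function is a weakly increasing function $u:\mathbb{R}\to\mathbb{R}$ with $u(0)=0$ (and $|u(t)|<\infty$ for all $t\in\mathbb{R}$). A weight function is any function $w:\mathbb{R}\times\mathbb{R}\to\mathbb{R}_{+}=[0,\infty)$ (with $w(t,s)<\infty$ for all $t,s\in\mathbb{R}$). A weighted separable attribute model, given by $u$ and $w$ (the same $u$ and $w$ for all attributes), evaluates an alternative $x$ in a binary menu $\{x,y\}$, where $x,y\in\mathbb{R}^{N}$ satisfy $x_{n}y_{n}\geq 0$ for all $n$, by $$V(x|\{x,y\})=\sum_{n=1}^{N}u(x_{n})\,w(x_{n},y_{n}).$$ In $V(x|\{x,y\})$, $x$ is the evaluated alternative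 and $y$ the comparison alternative, so $V(y|\{y,x\})=\sum_{n=1}^{N}u(y_{n})\,w(y_{n},x_{n})$. *)

(* Defs.v *)
From mathcomp Require Import all_boot all_order all_algebra.
From mathcomp Require Import reals.

Set Implicit Arguments.
Unset Strict Implicit.
Unset Printing Implicit Defensive.

Import Order.TTheory GRing.Theory Num.Theory.
Local Open Scope ring_scope.

Definition utility_function (R : realType) (u : R -> R) : Prop :=
  {homo u : s t / s <= t} /\ u 0 = 0.

Definition weight_function (R : realType) (w : R -> R -> R) : Prop :=
  forall t s, 0 <= w t s.

Definition binary_menu (R : realType) (N : nat) (x y : 'rV[R]_N) : Prop :=
  forall n, 0 <= x 0 n * y 0 n.

(* V(x|{x,y}).  The formula makes sense for all x and y; it is meant to be read
   only on pairs satisfying [binary_menu]. *)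
Definition evaluation (R : realType) (u : R -> R) (w : R -> R -> R)
    (N : nat) (x y : 'rV[R]_N) : R :=
  \sum_(n < N) u (x 0 n) * w (x 0 n) (y 0 n).

Definition utility0 (R : realType) (u : R -> R) (w : R -> R -> R) (t : R) : R :=
  u t * w t 0.

Definition alt2 (R : realType) (a b : R) : 'rV[R]_2 := \row_(n < 2) [:: a; b]`_n.

Lemma binary_menu_alt2 (R : realType) (x1 y2 : R) :
  binary_menu (alt2 x1 0) (alt2 0 y2).
Proof.
by case=> [[|[|//]]] i; rewrite !mxE /= ?mulr0 ?mul0r.
Qed.

Lemma binary_menu_row_mx (R : realType) (N1 N2 : nat) (x y : 'rV[R]_N1)
    (c : 'rV[R]_N2) :
  binary_menu x y -> binary_menu (row_mx x c) (row_mx y c).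
Proof.
move=> xy n; rewrite -(splitK n); case: (split n) => i /=.
  by rewrite !row_mxEl.
by rewrite !row_mxEr -expr2 sqr_ge0.
Qed.

(* Main.v *)
(* Since [u 0 = 0], the two evaluations are [u0 x1] and [u0 y2]; the constant
   attributes contribute the same summand to both sides and cancel. *)
Require Import Defs.
From mathcomp Require Import all_boot all_order all_algebra.
From mathcomp Require Import reals.

Set Implicit Arguments.
Unset Strict Implicit.
Unset Printing Implicit Defensive.

Import Order.TTheory GRing.Theory Num.Theory.
Local Open Scope ring_scope.

(** In each alternative the attribute with value 0 has utility 0, and the other one is weighted
    against 0. Equality of the evaluations thus reads [utility0 u w x1 = utility0 u w y2], and (b)
    says that [utility0 u w] is injective on the positive reals. By [lt_neq_injective_pos] this is
    (a). *)

Lemma evaluation_alt2l (R : realType) (u : R -> R) (w : R -> R -> R) (a b : R) :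
  u 0 = 0 -> evaluation u w (alt2 a 0) (alt2 0 b) = utility0 u w a.
Proof.
by move=> u0; rewrite /evaluation !big_ord_recl big_ord0 !mxE /= u0 mul0r !addr0.
Qed.

Lemma evaluation_alt2r (R : realType) (u : R -> R) (w : R -> R -> R) (a b : R) :
  u 0 = 0 -> evaluation u w (alt2 0 b) (alt2 a 0) = utility0 u w b.
Proof.
move=> u0; rewrite /evaluation !big_ord_recl big_ord0 !mxE /= u0 mul0r.
by rewrite add0r addr0.
Qed.

(** Used with [d := c]: swapping the two alternatives then leaves the second summand
    [evaluation u w c c] unchanged. *)
Lemma evaluation_row_mx (R : realType) (u : R -> R) (w : R -> R -> R)
    (N1 N2 : nat) (x y : 'rV[R]_N1) (c d : 'rV[R]_N2) :
  evaluation u w (row_mx x c) (row_mx y d) =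
  evaluation u w x y + evaluation u w c d.
Proof.
rewrite /evaluation big_split_ord /=.
by congr (_ + _); apply: eq_bigr => i _; rewrite ?row_mxEl ?row_mxEr.
Qed.

(** The order is total, so two distinct positive points can always be named so that the smaller one
    is [s]. *)
Lemma lt_neq_injective_pos (R : realType) (f : R -> R) :
  (forall t s, 0 < s -> s < t -> f t <> f s) <->
  (forall a b, 0 < a -> 0 < b -> f a = f b <-> a = b).
Proof.
split=> [finj a b a0 b0 | finj t s s0 st].
  split=> [fab | -> //]; case: (ltgtP a b) => // ab.
    by case: (finj b a a0 ab).
  by case: (finj a b b0 ab).
by move/(finj _ _ (lt_trans s0 st) s0) => ts; rewrite ts ltxx in st.
Qed.

Theorem proposition1 (R : realType) (u : R -> R) (w : R -> R -> R)
    (hu : utility_function u) (hw : weight_function w) :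
  ((forall t s : R, 0 < s -> s < t -> utility0 u w t <> utility0 u w s)
   <->
   (forall x1 y2 : R, 0 < x1 -> 0 < y2 ->
      let x := alt2 x1 0 in
      let y := alt2 0 y2 in
      evaluation u w x y = evaluation u w y x <-> x1 = y2))
  /\
  (forall (N : nat) (c : 'rV[R]_(N - 2)), (3 <= N)%N ->
     ((forall t s : R, 0 < s -> s < t -> utility0 u w t <> utility0 u w s)
      <->
      (forall x1 y2 : R, 0 < x1 -> 0 < y2 ->
         let x := row_mx (alt2 x1 0) c in
         let y := row_mx (alt2 0 y2) c in
         evaluation u w x y = evaluation u w y x <-> x1 = y2))).
Proof.
case: hu => _ u0; split=> [|N c _]; apply: (iff_trans (lt_neq_injective_pos _)).
  split=> h a b a0 b0; move: (h a b a0 b0); cbv zeta;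
  by rewrite evaluation_alt2l ?evaluation_alt2r.
(* Here [k] stands for [evaluation u w c c], the joint contribution of the constant attributes. *)
have cancel a b k : utility0 u w a + k = utility0 u w b + k <->
    utility0 u w a = utility0 u w b by split=> [/addIr|->].
split=> h a b a0 b0; move: (h a b a0 b0); cbv zeta;
  rewrite !evaluation_row_mx evaluation_alt2l ?evaluation_alt2r // => e.
- exact: iff_trans (cancel _ _ _) e.
- exact: iff_trans (iff_sym (cancel _ _ _)) e.
Qed.
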